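(* Let $\mathcal{H}$ be a separable complex Hilbert space, let $\{S_\gamma\}_{\gamma\in\Gamma}$ be a collection of finite-dimensional subspaces of $\mathcal{H}$ with $\Gamma$ an arbitrary index set, and put $\mathcal{X}:=\bigcup_{\gamma\in\Gamma}S_\gamma$ and $S_{\gamma,\theta}:=S_\gamma+S_\theta$ for $\gamma,\theta\in\Gamma$. Let $\Psi=\{\psi_i\}_{i\in I}$ be a Bessel sequence in $\mathcal{H}$ and, for every $\gamma,\theta\in\Gamma$, let $\Phi_{\gamma,\theta}$ be a frame for $S_{\gamma,\theta}$. Then the following are equivalent: (i) $\Psi$ provides a one-to-one sampling operator on $\mathcal{X}$, i.e. $A:\mathcal{H}\to\ell^2(I)$, $Af=\{\langle f,\psi_i\rangle\}_{i\in I}$, is injective on the set $\mathcal{X}$. (ii) $\dim(\operatorname{range}(G_{\Phi_{\gamma,\theta},\Psi}))=\dim(S_{\gamma,\theta})$ for all $\gamma,\theta\in\Gamma$.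
   Context: All index sets of sequences (such as $I$) are countable. A sequence $X=\{x_j\}_{j\in J}$ in a Hilbert space is a Bessel sequence if there is $0<\beta<\infty$ with $\sum_j|\langle h,x_j\rangle|^2\le\beta\|h\|^2$ for all $h$. It is a frame for a closed subspace $S$ if all $x_j\in S$ and there are $0<\alpha\le\beta<\infty$ with $\alpha\|h\|^2\le\sum_j|\langle h,x_j\rangle|^2\le\beta\|h\|^2$ for all $h\in S$. For a Bessel sequence $X=\{x_j\}_{j\in J}$, the analysis operator is $B_X:\mathcal{H}\to\ell^2(J)$, $B_Xh=\{\langle h,x_j\rangle\}_j$, and the synthesis operator is its adjoint $B_X^*c=\sum_jc_jx_j$. For Bessel sequences $X=\{x_j\}_{j\in J}$ and $Y=\{y_i\}_{i\in I}$ the cross-correlation operator is $G_{X,Y}:=B_YB_X^*:\ell^2(J)\to\ell^2(I)$, with matrix entries $(G_{X,Y})_{i,j}=\langle x_j,y_i\rangle$. *)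

(* Defs.v *)
From HB Require Import structures.
From mathcomp Require Import all_boot all_order all_algebra.
From mathcomp Require Export complex.
From mathcomp Require Import all_classical all_reals all_analysis.
From mathcomp.analysis.showcase Require summability.

Set Implicit Arguments.
Unset Strict Implicit.
Unset Printing Implicit Defensive.

Import Order.TTheory GRing.Theory Num.Theory.
Import numFieldNormedType.Exports.
Local Open Scope classical_set_scope.
Local Open Scope ring_scope.

Section LinearSpan.
Variables (K : fieldType) (V : lmodType K).
Implicit Types (A B : set V).

Definition lin_comb n (b : 'I_n -> V) (a : 'I_n -> K) : V :=
  \sum_(i < n) a i *: b i.

Definition lin_indep n (b : 'I_n -> V) : Prop :=
  forall a : 'I_n -> K, lin_comb b a = 0 -> forall i, a i = 0.

Definition is_basis n (b : 'I_n -> V) A : Prop :=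
  lin_indep b /\ A = range (lin_comb b).

Definition has_dim A (n : nat) : Prop := exists b : 'I_n -> V, is_basis b A.

(* A set with a finite basis is automatically a linear subspace. *)
Definition finite_dim A : Prop := exists n, has_dim A n.

Definition lin_dim A : \bar nat :=
  if pselect (finite_dim A) is left fdA then (sval (cid fdA))%:E else +oo%E.

Definition sum_set A B : set V := [set x + y | x in A & y in B].

End LinearSpan.

(* `|v| lives in R[i]; rnorm is the same norm, with values in R. *)
Definition rnorm (R : rcfType) (V : normedZmodType R[i]) (v : V) : R :=
  complex.Re `|v|.

Definition separable (T : topologicalType) : Prop :=
  exists2 D : set T, countable D & dense D.

Section Hilbert.
Variables (R : realType) (H : completeNormedModType R[i]).

(* A Hilbert space is a complete normed space H whose norm comes from ip.
   The form ip is linear in its first argument. *)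
Definition induces_norm (ip : {dot H for Num.conj}) : Prop :=
  forall x : H, ip x x = `|x| ^+ 2.

Variable ip : {dot H for Num.conj}.

Definition sqnorm2 (J : countType) (c : J -> R[i]^o) : \bar R :=
  (\esum_(j in [set: J]) (rnorm (c j) ^+ 2)%:E)%E.

Definition l2 (J : countType) : set (J -> R[i]^o) :=
  [set c | (sqnorm2 c < +oo)%E].

Definition analysis (J : countType) (X : J -> H) (h : H) : J -> R[i]^o :=
  fun j => ip h (X j).

Definition bessel (J : countType) (X : J -> H) : Prop :=
  exists2 b : R, 0 < b &
    forall h, (sqnorm2 (analysis X h) <= (b * rnorm h ^+ 2)%:E)%E.

Lemma bessel_analysis_l2 (J : countType) (X : J -> H) (h : H) :
  bessel X -> l2 (analysis X h).
Proof. by case=> b _ /(_ h) hb; apply: le_lt_trans hb _; rewrite ltry. Qed.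

Definition is_frame (J : countType) (X : J -> H) (S : set H) : Prop :=
  (forall j, S (X j)) /\
  exists a b : R, [/\ 0 < a, a <= b &
    forall h, S h ->
      ((a * rnorm h ^+ 2)%:E <= sqnorm2 (analysis X h) <= (b * rnorm h ^+ 2)%:E)%E].

(* The adjoint of the analysis operator, by its explicit formula: the
   unordered sum of the c j *: X j in the norm of H, which converges when X is
   a Bessel sequence and c is in l2. *)
Definition synthesis (J : countType) (X : J -> H) (c : J -> R[i]^o) : H :=
  summability.sum (fun j => (c j : R[i]) *: X j).

Definition cross_correlation (I J : countType) (X : J -> H) (Y : I -> H)
  : (J -> R[i]^o) -> (I -> R[i]^o) := analysis Y \o synthesis X.

Definition range_cross_correlation (I J : countType) (X : J -> H) (Y : I -> H)
  : set (I -> R[i]^o) := cross_correlation X Y @` l2 (J := J).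

End Hilbert.

(* Main.v *)
(* With T = S g + S t, the synthesis operator of a frame for T maps l2 onto T:
   its values lie in T because T is finite-dimensional, hence closed, and
   finitely many frame vectors already span T, since a vector of T orthogonal to
   the whole frame vanishes by the lower frame bound.  So the range of the
   cross-correlation operator is the image of T under the sampling operator A,
   and it has the dimension of T iff A is injective on T.  As T consists of the
   differences of elements of S g and S t, this is injectivity on the union. *)
From HB Require Import structures.
Require Import Defs.
From mathcomp Require Import all_boot all_order all_algebra finmap.
From mathcomp Require Import all_classical all_reals all_analysis.
From mathcomp Require Import ring lra.
From mathcomp.analysis.showcase Require summability.
Set Implicit Arguments.
Unset Strict Implicit.
Unset Printing Implicit Defensive.

Import Order.TTheory GRing.Theory Num.Theory.
Import numFieldNormedType.Exports.
Local Open Scope classical_set_scope.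
Local Open Scope ring_scope.

(** * Bases, spans and dimension of finite-dimensional subspaces *)

Section Dimension.
Variables (K : fieldType) (V : lmodType K).

Lemma lin_combP n (b : 'I_n -> V) (c : K) (u v : 'I_n -> K) :
  lin_comb b (fun i => c * u i + v i) = c *: lin_comb b u + lin_comb b v.
Proof.
rewrite /lin_comb scaler_sumr -big_split; apply: eq_bigr => i _ /=.
by rewrite scalerDl scalerA.
Qed.

Lemma lin_comb0 n (b : 'I_n -> V) : lin_comb b (fun=> 0) = 0.
Proof. by rewrite /lin_comb big1 // => i _; rewrite scale0r. Qed.

Lemma range_lin_comb_gen n (b : 'I_n -> V) i : range (lin_comb b) (b i).
Proof.
exists (fun j => (j == i)%:R) => //.
rewrite /lin_comb (bigD1 i) //= eqxx scale1r big1 ?addr0 // => j /negPf ->.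
by rewrite scale0r.
Qed.

Lemma range_lin_comb_sum n (b : 'I_n -> V) m (w : 'I_m -> K) (v : 'I_m -> V) :
  (forall i, range (lin_comb b) (v i)) -> range (lin_comb b) (lin_comb v w).
Proof.
move=> bv; rewrite [lin_comb v w]/lin_comb; elim/big_ind : _ => [|x y|i _].
- by exists (fun=> 0) => //; rewrite lin_comb0.
- move=> [a _ <-] [c _ <-]; exists (fun i => 1 * a i + c i) => //.
  by rewrite lin_combP scale1r.
- have [a _ <-] := bv i; exists (fun j => w i * a j + 0) => //.
  by rewrite (lin_combP b _ _ (fun=> 0)) lin_comb0 addr0.
Qed.

(** If m < n, the n by m matrix of coefficients of the [b i] over [c] has a nonzero row vector in
    its left kernel, whose entries are a nontrivial relation among the [b i]. *)
Lemma lin_indep_leq n m (b : 'I_n -> V) (c : 'I_m -> V) :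
  lin_indep b -> (forall i, range (lin_comb c) (b i)) -> (n <= m)%N.
Proof.
move=> bfree bc; rewrite leqNgt; apply/negP => ltmn.
have /choice[M MP] : forall i, exists a, lin_comb c a = b i.
  by move=> i; have [a _ <-] := bc i; exists a.
pose A := \matrix_(i, j) M i j : 'M[K]_(n, m).
have : kermx A != 0.
  by rewrite kermx_eq0 -row_leq_rank -ltnNge (leq_ltn_trans (rank_leq_col _)).
case/rowV0Pn => u /sub_kermxP uA /eqP; apply; apply/rowP => i; rewrite mxE.
apply: (bfree (u 0)).
transitivity (\sum_j (u *m A) 0 j *: c j); last first.
  by rewrite uA big1 // => j _; rewrite mxE scale0r.
under [RHS]eq_bigr do rewrite mxE scaler_suml.
rewrite exchange_big /=; apply: eq_bigr => k _.
rewrite -MP scaler_sumr; apply: eq_bigr => j _.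
by rewrite mxE scalerA.
Qed.

Lemma has_dim_uniq (A : set V) m n : has_dim A m -> has_dim A n -> m = n.
Proof.
move=> [b [bfree Ab]] [c [cfree Ac]]; apply/eqP; rewrite eqn_leq.
apply/andP; split.
- apply: (lin_indep_leq bfree (c := c)) => i; rewrite -Ac Ab.
  exact: range_lin_comb_gen.
- apply: (lin_indep_leq cfree (c := b)) => i; rewrite -Ab Ac.
  exact: range_lin_comb_gen.
Qed.

(** [lin_dim] picks a dimension by choice; uniqueness identifies the pick with n. *)
Lemma lin_dimE (A : set V) n : has_dim A n -> lin_dim A = n%:E.
Proof.
move=> An; rewrite /lin_dim; case: pselect => [fdA|[]]; last by exists n.
by congr (_%:E); apply: has_dim_uniq An; exact: svalP (cid fdA).
Qed.

Lemma lin_comb_solve m (b : 'I_m.+1 -> V) a i :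
  lin_comb b a = 0 -> a i != 0 -> range (lin_comb (b \o lift i)) (b i).
Proof.
rewrite /lin_comb (bigD1_ord i) //= => /eqP; rewrite addr_eq0 => /eqP ba ai.
exists (fun k => - (a i)^-1 * a (lift i k)) => //.
rewrite -[RHS]scale1r -(mulVf ai) -scalerA ba scalerN -scaleNr scaler_sumr.
by apply: eq_bigr => k _; rewrite scalerA.
Qed.

Lemma lin_dep_span m (c : 'I_m.+1 -> V) : ~ lin_indep c ->
  exists i, range (lin_comb c) = range (lin_comb (c \o lift i)).
Proof.
move=> /existsNP[a /not_implyP[ca /existsNP[i /eqP ai]]]; exists i.
apply/seteqP; split => _ [u _ <-]; apply: range_lin_comb_sum => j.
- have [k ->|->] := unliftP i j; first exact: (range_lin_comb_gen (c \o lift i)).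
  exact: lin_comb_solve ca ai.
- exact: range_lin_comb_gen.
Qed.

(** This is the step by which an independent subfamily of a frame is enlarged: a relation with
    nonzero coefficient at i would put [b i] in the span of the others. *)
Lemma lin_indep_lift m (b : 'I_m.+1 -> V) i :
  lin_indep (b \o lift i) -> ~ range (lin_comb (b \o lift i)) (b i) ->
  lin_indep b.
Proof.
move=> bfree bi a ba.
have ai : a i = 0.
  by apply: contrapT => /eqP ai; apply: bi; exact: lin_comb_solve ba ai.
move: ba; rewrite /lin_comb (bigD1_ord i) //= ai scale0r add0r => /bfree a0 j.
by have [k ->|->//] := unliftP i j; exact: (a0 k).
Qed.

(** Redundant vectors are deleted one at a time until the family is independent. *)
Lemma finite_dim_span m (c : 'I_m -> V) : finite_dim (range (lin_comb c)).
Proof.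
elim: m c => [|m IHm] c; first by exists 0, c; split => // a _ [].
have [cfree|/lin_dep_span[i ->]] := pselect (lin_indep c); last exact: IHm.
by exists m.+1, c.
Qed.

(** Were [c] dependent, one vector could be dropped, and m - 1 vectors would span a space containing
    m independent ones. *)
Lemma has_dim_span_indep m (c : 'I_m -> V) :
  has_dim (range (lin_comb c)) m -> lin_indep c.
Proof.
case: m c => [c _ a _ []//|m c [b [bfree cb]]].
apply: contrapT => /lin_dep_span[i ci].
suff : (m.+1 <= m)%N by rewrite ltnn.
apply: (lin_indep_leq bfree (c := c \o lift i)) => j; rewrite -ci cb.
exact: range_lin_comb_gen.
Qed.

(** The concatenation [d] of two bases spans the sum but may be dependent, hence the appeal to
    [finite_dim_span]. *)
Lemma finite_dim_sum_set (A B : set V) :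
  finite_dim A -> finite_dim B -> finite_dim (sum_set A B).
Proof.
move=> [m [b [_ ->]]] [n [c [_ ->]]].
pose d (i : 'I_(m + n)) := match fintype.split i with inl j => b j | inr k => c k end.
suff -> : sum_set (range (lin_comb b)) (range (lin_comb c)) = range (lin_comb d).
  exact: finite_dim_span.
have dl (j : 'I_m) : d (lshift n j) = b j by rewrite /d (unsplitK (inl j)).
have dr (k : 'I_n) : d (rshift m k) = c k by rewrite /d (unsplitK (inr k)).
apply/seteqP; split => [_ [_ [u _ <-]] [_ [v _ <-]] <-|_ [u _ <-]].
- exists (fun i => match fintype.split i with inl j => u j | inr k => v k end) => //.
  rewrite /lin_comb big_split_ord; congr (_ + _); apply: eq_bigr => k _ /=.
    by rewrite dl (unsplitK (inl k)).
  by rewrite dr (unsplitK (inr k)).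
- exists (lin_comb b (u \o lshift n)); first by eexists.
  exists (lin_comb c (u \o @rshift m n)); first by eexists.
  rewrite /lin_comb big_split_ord; congr (_ + _); apply: eq_bigr => k _ /=.
    by rewrite dl.
  by rewrite dr.
Qed.

Lemma finite_dim_comb (A : set V) a x y :
  finite_dim A -> A x -> A y -> A (a *: x + y).
Proof.
move=> [n [b [_ ->]]] [u _ <-] [v _ <-].
by exists (fun i => a * u i + v i); rewrite // lin_combP.
Qed.

Lemma finite_dim0 (A : set V) : finite_dim A -> A 0.
Proof. by move=> [n [b [_ ->]]]; exists (fun=> 0); rewrite // lin_comb0. Qed.

Lemma finite_dimZ (A : set V) a x : finite_dim A -> A x -> A (a *: x).
Proof.
by move=> fA Ax; rewrite -[_ *: _]addr0; apply: finite_dim_comb (finite_dim0 fA).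
Qed.

Lemma finite_dimB (A : set V) x y : finite_dim A -> A x -> A y -> A (x - y).
Proof. by move=> fA Ax Ay; rewrite addrC -scaleN1r; exact: finite_dim_comb. Qed.

Lemma finite_dim_sum (A : set V) (I : Type) (r : seq I) (F : I -> V) :
  finite_dim A -> (forall i, A (F i)) -> A (\sum_(i <- r) F i).
Proof.
move=> fA AF; elim/big_ind : _ => [|x y Ax Ay|//]; first exact: finite_dim0.
by rewrite -[x]scale1r; exact: finite_dim_comb.
Qed.

End Dimension.

(** * Dimension of a linear image *)

Section LinearImage.
Variables (K : fieldType) (V W : lmodType K) (f : {linear V -> W}).

Lemma linear_lin_comb n (b : 'I_n -> V) a :
  f (lin_comb b a) = lin_comb (f \o b) a.
Proof. by rewrite /lin_comb linear_sum; apply: eq_bigr => i _; rewrite linearZ. Qed.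

Lemma image_range_lin_comb n (b : 'I_n -> V) :
  f @` range (lin_comb b) = range (lin_comb (f \o b)).
Proof.
apply/seteqP; split => [_ [_ [a _ <-] <-]|_ [a _ <-]].
- by exists a => //; rewrite linear_lin_comb.
- by exists (lin_comb b a); [exists a|rewrite linear_lin_comb].
Qed.

(** The image of a basis of A spans the image of A, so the dimension is kept iff that family is
    still independent, that is, iff no nonzero vector of A is killed. *)
Lemma lin_dim_image (A : set V) : finite_dim A ->
  lin_dim (f @` A) = lin_dim A <-> forall x, A x -> f x = 0 -> x = 0.
Proof.
move=> [n [b [bfree Ab]]].
have An : has_dim A n by exists b.
rewrite (lin_dimE An); split=> [fAn x|finj].
- have : has_dim (f @` A) n.
    (* The image has some finite dimension m, being a span; the assumed equality of [lin_dim] then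
       forces m = n. *)
    rewrite Ab image_range_lin_comb; have [m mP] := finite_dim_span (f \o b).
    move: fAn mP; rewrite Ab image_range_lin_comb => fAn mP.
    by have := lin_dimE mP; rewrite fAn => -[nm]; move: mP; rewrite -nm.
  rewrite Ab image_range_lin_comb => /has_dim_span_indep fbfree [a _ <-].
  rewrite linear_lin_comb => /fbfree a0.
  by rewrite (_ : a = fun=> 0) ?lin_comb0 //; apply/funext.
- apply: lin_dimE; exists (f \o b); split; last by rewrite Ab image_range_lin_comb.
  move=> a; rewrite -linear_lin_comb => fa0; apply: bfree; apply: finj => //.
  by rewrite Ab; exists a.
Qed.

End LinearImage.

Lemma big_fset_split (V : nmodType) (I : choiceType) (A B : {fset I})
    (F : I -> V) : (A `<=` B)%fset ->
  \sum_(i <- B) F i = \sum_(i <- A) F i + \sum_(i <- (B `\` A)%fset) F i.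
Proof.
move=> /fsubsetP AB; rewrite (big_fsetID _ (mem A)); congr (_ + _).
- by apply: eq_fbigl => i; rewrite !inE /=; apply: andb_idl => /AB.
- by apply: eq_fbigl => i; rewrite !inE /= andbC.
Qed.

(** * The real-valued norm *)

Section RealNorm.
Variables (R : realType) (V : normedModType R[i]).
Implicit Types x y : V.

Lemma rnormE x : `|x| = (rnorm x)%:C%C.
Proof. by rewrite /rnorm RRe_real ?normr_real. Qed.

Lemma rnorm_ge0 x : 0 <= rnorm x.
Proof. by rewrite -lecR -rnormE; exact: normr_ge0. Qed.

Lemma rnorm_eq0 x : (rnorm x == 0) = (x == 0).
Proof. by rewrite -[RHS]normr_eq0 rnormE -(inj_eq (@complexI R)). Qed.

End RealNorm.

(** * Orthogonal projection and closedness of finite-dimensional subspaces *)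

Section InnerProduct.
Variables (R : realType) (H : completeNormedModType R[i]).
Variables (ip : {dot H for Num.conj}) (ip_norm : induces_norm ip).
Implicit Types (x y h : H) (A : set H).

Lemma ip_diag x : ip x x = (rnorm x ^+ 2)%:C%C.
Proof. by rewrite ip_norm rnormE rmorphXn. Qed.

Lemma ip_lin_combl n (b : 'I_n -> H) u y :
  ip (lin_comb b u) y = \sum_i u i * ip (b i) y.
Proof. by rewrite linear_sumlz; apply: eq_bigr => i _; rewrite linearZl_LR. Qed.

Lemma ip_lin_combr n (b : 'I_n -> H) u x :
  ip x (lin_comb b u) = \sum_i (u i)^* * ip x (b i).
Proof. by rewrite linear_sumr; apply: eq_bigr => i _; rewrite linearZr_LR. Qed.

Lemma ipBl x y z : ip (x - y) z = ip x z - ip y z.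
Proof. exact: linearBl. Qed.

Lemma ip_conj x y : ip y x = (ip x y)^*.
Proof. by rewrite hermC expr0 mul1r. Qed.

Lemma pythagoras x y : ip x y = 0 ->
  rnorm (x + y) ^+ 2 = rnorm x ^+ 2 + rnorm y ^+ 2.
Proof.
move=> xy; apply: (@complexI R).
by rewrite rmorphD /= -!ip_diag hnormDd.
Qed.

(** The coefficients of the projection solve the normal equations, whose matrix is the Gram matrix
    of a basis. *)
Lemma orth_proj A h : finite_dim A ->
  exists2 p, A p & forall y, A y -> ip (h - p) y = 0.
Proof.
move=> [n [b [bfree ->]]].
pose G := \matrix_(i, j) ip (b i) (b j) : 'M[R[i]]_n.
have ipb u j : ip (lin_comb b u) (b j) = ((\row_i u i) *m G) 0 j.
  by rewrite ip_lin_combl mxE; apply: eq_bigr => i _; rewrite !mxE.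
(* A kernel vector of [G] gives a combination orthogonal to every [b j], hence to itself, hence
   zero. *)
have Gfree : G \in unitmx.
  rewrite -row_free_unit -kermx_eq0; apply/negPn/negP => /rowV0Pn[u].
  move=> /sub_kermxP uG /eqP; apply; apply/rowP => i; rewrite mxE.
  apply: (bfree (u 0)); apply/eqP; rewrite -(dnorm_eq0 ip).
  rewrite ip_lin_combr big1 // => j _; rewrite ipb (_ : \row_i u 0 i = u); last first.
    by apply/rowP => k; rewrite mxE.
  by rewrite uG mxE mulr0.
pose v := \row_j ip h (b j) *m invmx G.
exists (lin_comb b (v 0)); first by exists (v 0).
move=> _ [w _ <-]; rewrite ip_lin_combr big1 // => j _.
rewrite ipBl ipb (_ : \row_i v 0 i = v); last first.
  by apply/rowP => k; rewrite mxE.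
by rewrite mulmxKV // mxE subrr mulr0.
Qed.

(** By Pythagoras every point of A is at distance at least |l - p| from l, where p is the projection
    of l; convergence to l thus forces l = p. *)
Lemma cvg_finite_dim A (T : Type) (F : set_system T) {FF : ProperFilter F}
    (f : T -> H) l :
  finite_dim A -> (forall t, A (f t)) -> f @ F --> l -> A l.
Proof.
move=> fA Af fl; have [p Ap lp] := orth_proj l fA.
suff /eqP : l - p = 0 by rewrite subr_eq0 => /eqP ->.
apply: contrapT => /eqP lp0.
have r0 : 0 < `|l - p| by rewrite normr_gt0.
have /cvgrPdist_lt/(_ _ r0)/filter_ex[t] := fl.
rewrite !rnormE ltcR ltNge => /negP; apply.
rewrite -(ler_pXn2r (n := 2)) ?nnegrE ?rnorm_ge0 //.
have -> : l - f t = (l - p) + (p - f t) by rewrite addrA subrK.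
rewrite [leRHS]pythagoras ?lerDl ?sqr_ge0 //; apply: lp; exact: finite_dimB.
Qed.

Lemma analysis_is_linear (J : countType) (X : J -> H) : linear (analysis ip X).
Proof. by move=> a x y; apply/funext => j; rewrite /analysis linearPl. Qed.

(** The linear structure makes [lin_dim_image] applicable to the sampling operator. *)
HB.instance Definition _ (J : countType) (X : J -> H) :=
  GRing.isLinear.Build R[i] H (J -> R[i]^o) *:%R (analysis ip X)
    (analysis_is_linear X).

End InnerProduct.

(** * Finite sums and tails of square-summable sequences *)

Section SquareSummable.
Variables (R : realType) (J : countType).
Implicit Types (c : J -> R[i]^o) (F : {fset J}).

Lemma fset_sum_le_sqnorm2 c F :
  ((\sum_(j <- F) rnorm (c j) ^+ 2)%:E <= sqnorm2 c)%E.
Proof.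
apply: esum_ge; exists [set` F]; first by split.
by rewrite fsbig_finite //= set_fsetK sumEFin.
Qed.

Lemma l2_fset c F : (forall j, j \notin F -> c j = 0) -> l2 c.
Proof.
move=> cF; rewrite /l2 /=.
have -> : sqnorm2 c = (\esum_(j in [set` F]) (rnorm (c j) ^+ 2)%:E)%E.
  rewrite [RHS]esum_mkcond; apply: eq_esum => j _; case: ifPn => // jF.
  rewrite cF; last by apply: contra jF => jF; rewrite inE.
  by rewrite /rnorm normr0 expr0n.
rewrite esum_fset //; last by move=> j _; rewrite lee_fin sqr_ge0.
by rewrite fsbig_finite //= sumEFin ltry.
Qed.

(** A is a finite set whose sum is within e of the supremum [sqnorm2 c], which also bounds the sum
    over B. *)
Lemma l2_tail c e : l2 c -> 0 < e -> exists A : {fset J},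
  forall B, (A `<=` B)%fset -> \sum_(j <- (B `\` A)%fset) rnorm (c j) ^+ 2 < e.
Proof.
move=> c2 e0.
have cfin : sqnorm2 c \is a fin_num.
  by rewrite ge0_fin_numE //; apply: esum_ge0 => j _; rewrite lee_fin sqr_ge0.
have [_ [A [finA _] <-] ltA] := ub_ereal_sup_adherent e0 cfin.
exists (fset_set A) => B AB.
have := fset_sum_le_sqnorm2 c B; move: ltA.
rewrite fsbig_finite // sumEFin -/(esum _ _) -/(sqnorm2 c) -(fineK cfin).
by rewrite -EFinB !lte_fin lee_fin (big_fset_split _ AB); lra.
Qed.

End SquareSummable.

(* The synthesis operator of a frame for a finite-dimensional subspace *)
#[local] Existing Instance summability.totally_filter.

Lemma partial_sumE (V : zmodType) (I : choiceType) (x : I -> V) :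
  summability.partial_sum x = fun A : {fset I} => \sum_(i <- A) x i.
Proof. by apply/funext => A; rewrite big_seq_fsetE. Qed.

Section Synthesis.
Variables (R : realType) (H : completeNormedModType R[i]).
Variables (ip : {dot H for Num.conj}) (ip_norm : induces_norm ip).
Variables (J : countType) (X : J -> H).
Implicit Types (c : J -> R[i]^o) (F : {fset J}) (S : set H).

Lemma synthesis_fset c F : (forall j, j \notin F -> c j = 0) ->
  synthesis X c = \sum_(j <- F) (c j : R[i]) *: X j.
Proof.
move=> cF; rewrite /synthesis /summability.sum partial_sumE.
apply: (cvg_lim (@norm_hausdorff _ _)); apply: cvg_near_cst.
exists F => // G /= FG; symmetry; apply: big_fset_incl => // j _ /cF ->.
by rewrite scale0r.
Qed.

(* The pairing of the sum with itself is estimated by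
   [2 |c j| |<s, X j>| <= b |c j|^2 + |<s, X j>|^2 / b]. *)
Lemma fset_sum_bessel (b : R) c F (s := \sum_(j <- F) (c j : R[i]) *: X j) :
  0 < b -> \sum_(j <- F) rnorm (analysis ip X s j) ^+ 2 <= b * rnorm s ^+ 2 ->
  rnorm s ^+ 2 <= b * \sum_(j <- F) rnorm (c j) ^+ 2.
Proof.
move=> b0 bs.
have normM (z w : R[i]) :
    rnorm (z * w : R[i]^o) = rnorm (z : R[i]^o) * rnorm (w : R[i]^o).
  by apply: (@complexI R); rewrite rmorphM -!rnormE -normrM.
have : rnorm s ^+ 2 <= \sum_(j <- F) rnorm (c j) * rnorm (analysis ip X s j).
  rewrite -lecR -(ip_diag ip_norm) rmorph_sum /=.
  rewrite -[leLHS]ger0_norm ?dnorm_ge0 // {1}/s linear_sumlz.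
  apply: le_trans (ler_norm_sum _ _ _) _; apply: ler_sum => j _.
  rewrite linearZl_LR /= normrM rmorphM /= -!rnormE.
  by rewrite ip_conj norm_conjC.
move=> /le_trans; move: bs; set r := rnorm s ^+ 2; set d := analysis ip X s.
move=> bs le_r.
have AMGM j : rnorm (c j) * rnorm (d j) <=
    2^-1 * (b * rnorm (c j) ^+ 2 + b^-1 * rnorm (d j) ^+ 2).
  have bV : b * b^-1 = 1 by rewrite mulfV ?gt_eqF.
  have := mulr_ge0 (ltW b0) (sqr_ge0 (rnorm (c j) - b^-1 * rnorm (d j))).
  have -> : b * (rnorm (c j) - b^-1 * rnorm (d j)) ^+ 2 =
      b * rnorm (c j) ^+ 2 - 2 * (b * b^-1) * (rnorm (c j) * rnorm (d j)) +
      (b * b^-1) * b^-1 * rnorm (d j) ^+ 2 by ring.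
  by rewrite bV; lra.
have := le_r _ (ler_sum F (fun j _ => AMGM j)).
rewrite -mulr_sumr big_split /= -!mulr_sumr.
(* By [bs] the second sum contributes at most r / 2, which the left side absorbs. *)
have : b^-1 * (\sum_(j <- F) rnorm (d j) ^+ 2) <= r.
  by rewrite ler_pdivrMl.
lra.
Qed.

(* Convergence has to be proved here: the limit of a divergent filter in H is an
   arbitrary point of H, which need not lie in S. *)
Lemma synthesis_mem S c : finite_dim S -> is_frame ip X S -> l2 c ->
  S (synthesis X c).
Proof.
move=> fS [XS [a [b [a0 ab Xab]]]] c2.
have b0 : 0 < b by exact: lt_le_trans ab.
pose s F := \sum_(j <- F) (c j : R[i]) *: X j.
have Ss F : S (s F).
  by apply: finite_dim_sum => // j; exact: finite_dimZ.
(* The upper frame bound holds on S only; it applies to the partial sum [s F] because that lies in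
   S. *)
have s_le F : rnorm (s F) ^+ 2 <= b * \sum_(j <- F) rnorm (c j) ^+ 2.
  apply: fset_sum_bessel => //.
  rewrite -lee_fin; have /andP[_] := Xab _ (Ss F).
  by apply: le_trans; exact: fset_sum_le_sqnorm2.
suff scvg : cvg (s @ summability.totally).
  rewrite /synthesis /summability.sum partial_sumE.
  exact: (cvg_finite_dim ip_norm fS Ss scvg).
apply/cauchy_cvgP/cauchy_exP => e e0.
(* The radius e lives in [R[i]]; being positive, it is real. *)
have eE : e = (complex.Re e)%:C%C by rewrite RRe_real // gtr0_real.
have e0' : 0 < complex.Re e by rewrite -ltcR -eE.
(* A tail below e^2 / b makes [s_le] bound the remaining partial sums by e in norm. *)
have [|A ltA] := l2_tail c2 (e := b^-1 * complex.Re e ^+ 2).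
  by rewrite mulr_gt0 ?invr_gt0 ?exprn_gt0.
exists (s A), A => // B /= AB.
rewrite -ball_normE /ball_ /= /s (big_fset_split _ AB) opprD addNKr normrN.
rewrite rnormE eE ltcR -(ltr_pXn2r (n := 2)) ?nnegrE ?rnorm_ge0 1?ltW //.
apply: le_lt_trans (s_le _) _; rewrite -ltr_pdivlMl //; exact: ltA.
Qed.

(** Take an independent subfamily of the frame of maximal size, which exists as sizes are at most n.
    If the residual [h - p] were not orthogonal to some [X j], adding [X j] would give a larger
    one. *)
Lemma frame_spans S : finite_dim S -> is_frame ip X S ->
  exists m (k : 'I_m -> J), S `<=` range (lin_comb (X \o k)).
Proof.
move=> [n [u [ufree uS]]] [XS [a [b [a0 _ Xab]]]].
have fS : finite_dim S by exists n, u.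
pose P m := `[< exists k : 'I_m -> J, lin_indep (X \o k) >].
have P0 : exists m, P m.
  (* J may be empty, so the empty family is built from the emptiness of ['I_0]. *)
  by exists 0; apply/asboolP; exists (ffun0 (rT := fun=> J) (card_ord 0)) => c _ [].
have Pn m : P m -> (m <= n)%N.
  move=> /asboolP[k kfree]; apply: (lin_indep_leq kfree (c := u)) => i.
  by rewrite -uS; exact: XS.
have [m /asboolP[k kfree] m_max] := ex_maxnP P0 Pn.
exists m, k => h Sh.
have [p kp hp] := orth_proj ip h (finite_dim_span (X \o k)).
suff /eqP : h - p = 0 by rewrite subr_eq0 => /eqP ->.
have Sp : S p.
  move: kp => [w _ <-]; apply: finite_dim_sum => // i.
  by apply: finite_dimZ => //=.
have [hpX|/existsNP[j hpj]] :=
    pselect (forall j, ip (h - p) (X j) = 0).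
  (* All frame coefficients of [h - p] vanish, so the lower bound gives a |h - p|^2 <= 0. *)
  apply/eqP; rewrite -rnorm_eq0 -sqrf_eq0 eq_le sqr_ge0 andbT.
  have /andP[+ _] := Xab _ (finite_dimB fS Sh Sp).
  rewrite /sqnorm2 esum1; last first.
    by move=> j _; rewrite /analysis hpX /rnorm normr0 expr0n.
  by rewrite lee_fin pmulr_rle0.
have /m_max : P m.+1; last by rewrite ltnn.
pose k' (i : 'I_m.+1) := oapp k j (unlift ord0 i).
have k'E : (X \o k') \o lift ord0 = X \o k.
  by apply/funext => i; rewrite /= /k' liftK.
apply/asboolP; exists k'; apply: (lin_indep_lift (i := ord0)); rewrite k'E //=.
by rewrite /k' unlift_none /= => /hp.
Qed.

Lemma synthesis_surj S h : finite_dim S -> is_frame ip X S -> S h ->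
  exists2 c, l2 c & synthesis X c = h.
Proof.
move=> fS Xframe Sh; have [m [k Sk]] := frame_spans fS Xframe.
have [a _ <-] := Sk _ Sh.
pose F := [fset k i | i in 'I_m]%fset.
(* Several i may share the same [k i], so [c j] collects the coefficients of all i with k i = j. *)
pose c j : R[i]^o := \sum_i (k i == j)%:R * a i.
have cF j : j \notin F -> c j = 0.
  move=> jF; apply: big1 => i _; case: eqP => [kij|_]; last by rewrite mul0r.
  by case/negP: jF; apply/imfsetP; exists i.
exists c; first exact: l2_fset cF.
rewrite (synthesis_fset cF) /c.
under eq_bigr do rewrite scaler_suml.
rewrite exchange_big; apply: eq_bigr => i _ /=.
have kiF : k i \in F by apply/imfsetP; exists i.
rewrite (big_fsetD1 _ kiF) /= eqxx mul1r big1_fset ?addr0 // => j.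
by rewrite !inE => /andP[/negPf jk _] _; rewrite eq_sym jk mul0r scale0r.
Qed.

Lemma image_synthesis S : finite_dim S -> is_frame ip X S ->
  synthesis X @` l2 (J := J) = S.
Proof.
move=> fS Xframe; apply/seteqP; split => [_ [c c2 <-]|h Sh].
- exact: synthesis_mem.
- exact: synthesis_surj Sh.
Qed.

End Synthesis.

(** * Injectivity on the union against the ranks of the cross-correlations *)

Theorem theorem4p3 (R : realType) (H : completeNormedModType R[i])
  (ip : {dot H for Num.conj}) (ip_norm : induces_norm ip)
  (H_separable : separable H)
  (Gamma : Type) (S : Gamma -> set H)
  (S_finite_dim : forall g, finite_dim (S g))
  (I : countType) (Psi : I -> H) (Psi_bessel : bessel ip Psi)
  (J : Gamma -> Gamma -> countType) (Phi : forall g t, J g t -> H)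
  (Phi_frame : forall g t, is_frame ip (Phi g t) (sum_set (S g) (S t))) :
  set_inj (\bigcup_(g in [set: Gamma]) S g) (analysis ip Psi)
  <->
  forall g t, lin_dim (range_cross_correlation ip (Phi g t) Psi)
              = lin_dim (sum_set (S g) (S t)).
Proof.
have fS g t := finite_dim_sum_set (S_finite_dim g) (S_finite_dim t).
have rangeE g t : range_cross_correlation ip (Phi g t) Psi =
    analysis ip Psi @` sum_set (S g) (S t).
  rewrite /range_cross_correlation /cross_correlation -image_comp.
  by rewrite (image_synthesis ip_norm (fS g t) (Phi_frame g t)).
split=> [Psi_inj g t|dimE x y].
- rewrite rangeE; apply/(lin_dim_image _ (fS g t)) => _ [x Sx [y Sy <-]] xy0.
  have SNy : S t (- y).
    rewrite -sub0r; apply: finite_dimB => //; exact: finite_dim0.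
  (* The kernel element x + y is the difference of x in [S g] and -y in [S t], two points of the
     union with equal samples. *)
  suff -> : x = - y by rewrite addNr.
  apply: Psi_inj; rewrite ?inE; [by exists g|by exists t|].
  by apply/eqP; rewrite -subr_eq0 -linearB /= opprK xy0.
- rewrite !inE => -[g _ Sx] [t _ Sy] xy; apply/eqP; rewrite -subr_eq0; apply/eqP.
  (* Conversely, x - y lies in the sum of [S g] and [S t] and has zero samples. *)
  have := dimE g t; rewrite rangeE => /(lin_dim_image _ (fS g t)); apply.
    exists x => //; exists (- y) => //.
    rewrite -sub0r; apply: finite_dimB => //; exact: finite_dim0.
  by rewrite linearB /= xy subrr.
Qed.
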